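(* If a normal $C_0$-semigroup on a complex infinite-dimensional Hilbert space is eventually compact, then it is immediately compact.
   Context: A normal $C_0$-semigroup is a $C_0$-semigroup of (bounded) normal operators on a complex Hilbert space; equivalently, one generated by a (possibly unbounded) normal operator. A $C_0$-semigroup $\{T(t)\}_{t\ge0}$ is eventually compact if there exists $t_0>0$ such that $T(t_0)$ is compact (and hence $T(t)$ is compact for all $t\ge t_0$); it is immediately compact if $T(t)$ is compact for every $t>0$. *)

(* Defs.v *)
From HB Require Import structures.
From mathcomp Require Import all_boot all_order all_algebra.
From mathcomp Require Import all_classical all_reals all_analysis.
From mathcomp Require Import complex.

Set Implicit Arguments.
Unset Strict Implicit.
Unset Printing Implicit Defensive.

Import Order.TTheory GRing.Theory Num.Theory.
Import numFieldNormedType.Exports.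

Local Open Scope classical_set_scope.
Local Open Scope ring_scope.

(* A complex Hilbert space is a complete normed module over R[i] whose norm is
   induced by a positive definite form, linear in its first argument and
   conjugate-linear in its second one. *)
Definition induces_norm (R : realType) (H : completeNormedModType R[i])
    (dot : {dot H for Num.conj}) : Prop :=
  forall x : H, `|x| ^+ 2 = dot x x.

Definition infinite_dimensional (K : fieldType) (V : lmodType K) : Prop :=
  ~ exists (n : nat) (e : 'I_n -> V),
      forall x : V, exists c : 'I_n -> K, x = \sum_(i < n) c i *: e i.

Section Operators.
Variables (R : realType) (H : completeNormedModType R[i]).
Implicit Types A B : {linear H -> H}.

(* For a linear map this is boundedness in the sense |A x| <= M * |x|, see
   linear_boundedP. *)
Definition bounded_operator A : Prop := bounded_near A (nbhs (0 : H)).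

Definition is_adjoint (dot : {dot H for Num.conj}) A B : Prop :=
  forall x y : H, dot (A x) y = dot x (B y).

(* Adjoints are unique, and every bounded A has one (which is bounded), so B
   below is the adjoint of A. *)
Definition normal_operator (dot : {dot H for Num.conj}) A : Prop :=
  bounded_operator A /\
  exists B, is_adjoint dot A B /\ forall x : H, A (B x) = B (A x).

Definition compact_operator A : Prop :=
  precompact (A @` [set x : H | `|x| <= 1]).

(* Semigroups are indexed by R, but their values at negative times are
   irrelevant: no definition below constrains or uses them. *)
Definition C0_semigroup (T : R -> {linear H -> H}) : Prop :=
  [/\ forall t : R, 0 <= t -> bounded_operator (T t),
      forall x : H, T 0 x = x,
      forall (s t : R) (x : H), 0 <= s -> 0 <= t -> T (s + t) x = T s (T t x)
    & forall x : H, T t x @[t --> (0 : R)^'+] --> x].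

Definition normal_C0_semigroup (dot : {dot H for Num.conj})
    (T : R -> {linear H -> H}) : Prop :=
  C0_semigroup T /\ forall t : R, 0 <= t -> normal_operator dot (T t).

Definition eventually_compact (T : R -> {linear H -> H}) : Prop :=
  exists2 t0 : R, 0 < t0 & compact_operator (T t0).

Definition immediately_compact (T : R -> {linear H -> H}) : Prop :=
  forall t : R, 0 < t -> compact_operator (T t).

End Operators.

(* Main.v *)
(** If A is normal, then A and its adjoint have the same norm on A x, so
    |A x|^2 = <A* (A x), x> <= |A (A x)| |x|: on the unit ball A is small
    wherever A^2 is, hence A is compact as soon as A^2 is. Applied to the
    semigroup, compactness of T(t0) thus passes to T(t0 / 2^n) for every n;
    for t >= t0 / 2^n, T(t) = T(t - t0 / 2^n) T(t0 / 2^n) is then compact. *)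
Require Import Defs.
From HB Require Import structures.
From mathcomp Require Import all_boot all_order all_algebra.
From mathcomp Require Import all_classical all_reals all_analysis.
From mathcomp Require Import complex ring.

Import Order.TTheory GRing.Theory Num.Theory.
Import numFieldNormedType.Exports.

Local Open Scope classical_set_scope.
Local Open Scope ring_scope.

Lemma ultra_fmap (T U : Type) (f : T -> U) (G : set_system T) :
  UltraFilter G -> UltraFilter (f @ G).
Proof.
move=> GU; split=> [|F FF sGF]; first exact: fmap_proper_filter.
rewrite predeqE => A; split=> [FA|]; last exact: sGF.
have [//|GnA] := in_ultra_setVsetC (f @^-1` A) GU.
have /(filterI FA) : F (~` A) by exact: sGF.
by rewrite setICr => /filter_not_empty.
Qed.

(** Ultrafilters live on the domain, so that a single [G] can be pushed along two different maps,
    such as an operator and its square, and the two images compared. *)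
Lemma precompact_imageP (T : Type) (X : completeType) (f : T -> X)
    (B : set T) :
  precompact (f @` B) <->
  (forall G : set_system T, UltraFilter G -> G B -> cauchy (f @ G)).
Proof.
split=> [[K fBK [cK _]] G GU GB | fcauchy].
  have fGU := ultra_fmap _ _ f G GU.
  move: cK; rewrite compact_ultra => /(_ _ fGU)[|p [_ fGp]].
    by apply: (@filterS _ G _ B _ _ GB) => x Bx; apply: fBK; exists x.
  by apply: cvg_cauchy; apply/cvg_ex; exists p.
rewrite precompactE compact_ultra => F FU FB.
(* F contains only the closure of f @` B, so it cannot be pulled back along f
   directly: thicken its members by entourages first. *)
pose N (DE : set X * set (X * X)) :=
  [set x | B x /\ exists2 z, DE.1 z & DE.2 (f x, z)].
pose base : set (set X * set (X * X)) := [set DE | F DE.1 /\ entourage DE.2].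
have NF : ProperFilter (filter_from base N).
  apply: filter_from_proper; first apply: filter_from_filter.
  - by exists (setT, setT); split; [exact: filterT | exact: entourageT].
  - move=> [D E] [D' E'] [/= FD eE] [/= FD' eE'].
    exists (D `&` D', E `&` E'); first by split; exact: filterI.
    by move=> x [Bx [/= z [Dz D'z] [Ez E'z]]]; split; split => //; exists z.
  - move=> [D E] [/= FD eE].
    have /filter_ex[z [Dz]] : F (D `&` closure (f @` B)) by exact: filterI.
    have eE1 : nbhs z (xsection (E^-1)%relation z).
      by apply: nbhs_entourage; exact: entourage_inv.
    move=> /(_ _ eE1)[_ [[x Bx <-] /xsectionP Ezx]].
    by exists x; split => //; exists z.
have [G [GU sNG]] := ultraFilterLemma NF.
have GB : G B.
  apply: sNG; exists (setT, setT); last by move=> x [].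
  by split; [exact: filterT | exact: entourageT].
have fGp := cauchy_cvg (f @ G) (fcauchy G GU GB).
set p := lim (f @ G) in fGp.
have Fp : F --> p.
  (* [G] contains both [N (D, split_ent E)] and the points that [f] sends near [p]. A common point
     [x] has [f x] close to [p] and to some [z] in [D], which puts [z] close to [p]. *)
  suff : cluster F p by rewrite ultra_cvg_clusterE.
  move=> D V FD; rewrite -nbhs_entourageE => -[E eE EV].
  have G1 : G (N (D, split_ent E)).
    by apply: sNG; exists (D, split_ent E) => //; split => //=.
  have G2 : G (f @^-1` xsection (split_ent E) p).
    by apply: fGp; exact: nbhs_entourage.
  have [x [[_ [/= z Dz Exz]] /xsectionP Epx]] := filter_ex (filterI G1 G2).
  exists z; split => //; apply: EV; apply/xsectionP.
  exact: (entourage_split (f x)).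
exists p; split => //; rewrite (closure_id (closure _)).1; last first.
  exact: closed_closure.
by move=> V /Fp FV; exact: filter_ex (filterI FB FV).
Qed.

Lemma dot_CauchySchwarz (C : numClosedFieldType) (U : lmodType C)
    (dot : {dot U for Num.conj}) (u v : U) :
  `|dot u v| ^+ 2 <= dot u u * dot v v.
Proof.
have [->|v0] := eqVneq v 0; first by rewrite linear0r normr0 expr0n linear0l mulr0.
have v_gt0 : 0 < dot v v by rewrite dnorm_gt0.
(* This is the component of [u] orthogonal to [v], scaled by [dot v v] to avoid division. *)
set w := dot v v *: u - dot u v *: v.
suff wE : dot w w = dot v v * (dot u u * dot v v - `|dot u v| ^+ 2).
  by rewrite -subr_ge0 -(pmulr_rge0 _ v_gt0) -wE dnorm_ge0.
have vC : (dot v v)^* = dot v v by apply/CrealP/ger0_real/ltW.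
have dE : dot (dot v v *: u) (dot u v *: v) = dot v v * `|dot u v| ^+ 2.
  by rewrite linearZl_LR linearZr_LR /= normCKC.
rewrite /w dnormB dE rmorphM /= vC !dnormZ.
rewrite (CrealP (rpredX 2 (normr_real _))) ger0_norm ?ltW//.
ring.
Qed.

(** By completeness the Cauchy filter [B @ G] converges, and the continuous [A] preserves
    convergence. *)
Lemma compact_operator_comp (R : realType) (H : completeNormedModType R[i])
    (A B C : {linear H -> H}) :
  bounded_operator A -> compact_operator B -> (forall x, C x = A (B x)) ->
  compact_operator C.
Proof.
move=> /bounded_linear_continuous cA; rewrite /compact_operator.
move=> + CE; rewrite !precompact_imageP => cB G GU GB.
have BG := ultra_fmap _ _ B G GU.
have cvB : cvg (B @ G) by apply: cauchy_cvg; exact: cB.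
have -> : (C : H -> H) = A \o B by apply/funext.
apply: cvg_cauchy; apply/cvg_ex; exists (A (lim (B @ G))).
by apply: (cvg_comp B A cvB); exact: cA.
Qed.

Lemma normal_operator_norm (R : realType) (H : completeNormedModType R[i])
    (dot : {dot H for Num.conj}) (A : {linear H -> H}) :
  induces_norm dot -> normal_operator dot A ->
  forall x, `|A x| ^+ 2 <= `|x| * `|A (A x)|.
Proof.
move=> hdot [_ [B [adjAB AB]]] x.
(* Writing <,> for [dot]: <Bz, Bz> = <ABz, z> = <BAz, z>, which is the conjugate of <z, BAz> = <Az,
   Az>, a real number. *)
have normB z : `|B z| ^+ 2 = `|A z| ^+ 2.
  rewrite hdot -adjAB AB hermC /= expr0 mul1r -adjAB -hdot.
  by apply/CrealP/rpredX/normr_real.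
rewrite -ler_sqr ?nnegrE ?mulr_ge0 ?exprn_ge0//.
rewrite [leRHS]exprMn -(normB (A x)).
have := dot_CauchySchwarz _ _ dot x (B (A x)).
by rewrite -adjAB -!hdot normrX normr_id.
Qed.

Lemma compact_operator_sqrt (R : realType) (H : completeNormedModType R[i])
    (dot : {dot H for Num.conj}) (A C : {linear H -> H}) :
  induces_norm dot -> normal_operator dot A -> (forall x, C x = A (A x)) ->
  compact_operator C -> compact_operator A.
Proof.
move=> hdot nA CE; rewrite /compact_operator !precompact_imageP => cC G GU GB.
apply/cauchy_ballP => e e0.
(* Points [x], [y] of the unit ball are at distance at most 2, so [C x] and [C y] within
   [e ^+ 2 / 2] give |A (x - y)|^2 <= 2 |C (x - y)| < e^2. *)
have /cauchy_ballP /(_ (e ^+ 2 / 2)) := cC G GU GB.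
have e20 : 0 < e ^+ 2 / 2 by rewrite divr_gt0 ?exprn_gt0.
(* [V] carries a set of values of [C] to the values of [A] at the same points of the unit ball. *)
pose V P := A @` ([set x | `|x| <= 1] `&` C @^-1` P).
have GV P : (C @ G) P -> (A @ G) (V P).
  move=> GP; apply: (@filterS _ G _ _ _ _ (filterI GB (GP : G (C @^-1` P)))).
  by move=> x Px; exists x.
move=> /(_ e20) [[P Q] [/= /GV GP /GV GQ] PQ]; exists (V P, V Q); first by [].
move=> [_ _] [/= [x [x1 Px] <-] [y [y1 Qy] <-]].
have /= := PQ (C x, C y) (conj Px Qy).
rewrite -!ball_normE /= -(linearB C) -(linearB A) CE => Cxy.
have xy2 : `|x - y| <= 2 by rewrite (le_trans (ler_normB _ _))// lerD.
rewrite -ltr_sqr ?nnegrE ?(ltW e0)//.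
rewrite (le_lt_trans (normal_operator_norm _ _ _ _ hdot nA _))//.
rewrite (le_lt_trans (ler_wpM2r _ xy2))//.
by rewrite mulrC -ltr_pdivlMr.
Qed.

Theorem corollary6p11 (R : realType) (H : completeNormedModType R[i])
    (dot : {dot H for Num.conj}) (hdot : induces_norm dot)
    (hinf : infinite_dimensional H)
    (T : R -> {linear H -> H}) (hT : normal_C0_semigroup dot T)
    (hcpt : eventually_compact T) :
  immediately_compact T.
Proof.
case: hT => -[bT _ TD _] nT; case: hcpt => t0 t0_gt0 cT t t_gt0.
have cTn n : compact_operator (T (t0 / 2 ^+ n)).
  elim: n => [|n IH]; first by rewrite expr0 divr1.
  have t0n : 0 <= t0 / 2 ^+ n.+1 by rewrite divr_ge0 ?exprn_ge0 ?ltW.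
  apply: (compact_operator_sqrt _ _ _ _ _ hdot (nT _ t0n) _ IH) => x.
  rewrite -TD//; congr (T _ x).
  by rewrite exprS; field; rewrite expf_neq0.
have [n t0t] : exists n, t0 / 2 ^+ n <= t.
  (* For this [n], [upper_nthrootP] gives t0 / t < 2^n. *)
  exists (Num.bound (t0 / t)); rewrite ler_pdivrMr ?exprn_gt0// mulrC.
  by rewrite -ler_pdivrMr//; exact: ltW (upper_nthrootP (leqnn _)).
have t0n : 0 <= t0 / 2 ^+ n by rewrite divr_ge0 ?exprn_ge0 ?ltW.
have d0 : 0 <= t - t0 / 2 ^+ n by rewrite subr_ge0.
apply: (compact_operator_comp _ _ _ _ _ (bT _ d0) (cTn n)) => x.
by rewrite -TD// subrK.
Qed.
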